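(* Assume that for every object $X$ the coequalizer $\rho_X\colon DX\to\tilde DX$ of $\iota_X^*,\ D\mathrm{fst}\colon D(X\times\mathbb{N})\to DX$ exists and is preserved by products (so $\tilde D$ is a functor and $\rho$ natural). The following are equivalent: (1) for every $X$, this coequalizer is preserved by $D$; (2) for every $X$ there is $\alpha_X\colon D\tilde DX\to\tilde DX$ such that $(\tilde DX,\alpha_X)$ is a search-algebra and $\rho_X$ is a $D$-algebra morphism from $(DX,\mu_X)$, i.e. $\rho_X\mu_X=\alpha_X\,D\rho_X$; (3) for every $X$, $\tilde DX$ carries an Elgot algebra structure $(-)^\dagger$ such that, with unit $\rho_X\,\mathrm{now}\colon X\to\tilde DX$, it is a stable free Elgot algebra on $X$, $\rho_X$ is a $D$-algebra morphism from $(DX,\mu_X)$ to $(\tilde DX,\mathrm{out}^\dagger)$, and $\rho_X=((\rho_X\,\mathrm{now}+\mathrm{id})\,\mathrm{out})^\dagger$; (4) $\tilde D$ extends to a strong monad such that $\rho\colon\mathbb{D}\to\tilde D$ is a strong monad morphism.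
   Context: $\mathbf{C}$ is an extensive category with finite products, a stable natural number object $(\mathbb{N},o,s)$ and exponentials $X^{\mathbb{N}}$; $\mathrm{dstr}$ is the distributivity isomorphism. $DX$ is the final coalgebra of $X+(-)$ with invertible structure $\mathrm{out}\colon DX\to X+DX$, $\mathrm{now}=\mathrm{out}^{-1}\mathrm{inl}$, $\mathrm{later}=\mathrm{out}^{-1}\mathrm{inr}$. $\mathbb{D}$ is the (strong) delay monad: unit $\mathrm{now}$, Kleisli lifting $f^*$ unique with $\mathrm{out}\,f^*=[\mathrm{out}\,f,\mathrm{inr}\,f^*]\mathrm{out}$, $\mu=\mathrm{id}^*$, strength $\tau$ unique with $\mathrm{out}\,\tau=(\mathrm{id}+\tau)\mathrm{dstr}(\mathrm{id}\times\mathrm{out})$. $\iota_X\colon X\times\mathbb{N}\to DX$: $\iota(x,o)=\mathrm{now}(x)$, $\iota(x,s(n))=\mathrm{later}(\iota(x,n))$. Preservation by products: $Y\times\rho_X$ is a coequalizer of $Y\times\iota^*$, $Y\times D\mathrm{fst}$ for all $Y$. A $D$-algebra is $(A,a\colon DA\to A)$; a search-algebra is one with $a\,\mathrm{now}=\mathrm{id}$ and $a\,\mathrm{later}=a$. An Elgot algebra is an object $A$ with an operator $f\mapsto f^\dagger$ ($f\colon Z\to A+Z$, $f^\dagger\colon Z\to A$) satisfying (Fixpoint) $f^\dagger=[\mathrm{id},f^\dagger]f$, (Uniformity) $(\mathrm{id}+h)f=gh\Rightarrow f^\dagger=g^\dagger h$, (Compositionality) $((f^\dagger+\mathrm{id})h)^\dagger=([(\mathrm{id}+\mathrm{inl})f,\mathrm{inr}\,\mathrm{inr}][\mathrm{inl},h])^\dagger\mathrm{inr}$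 for $h\colon Y\to X+Y$, $f\colon X\to A+X$. For Elgot algebras $B,C$, $g\colon W\times B\to C$ is right iteration preserving if $g(\mathrm{id}\times h^\dagger)=((g+\mathrm{id})\mathrm{dstr}(\mathrm{id}\times h))^\dagger$ for all $h\colon Z\to B+Z$. ''Stable free Elgot algebra on $X$'' with unit $u\colon X\to\tilde DX$ means: for every object $W$, Elgot algebra $A$ and $f\colon W\times X\to A$ there is a unique right iteration preserving $f^\#\colon W\times\tilde DX\to A$ with $f=f^\#(\mathrm{id}\times u)$. *)

(* Defs.v *)
Set Implicit Arguments.
Unset Strict Implicit.
Unset Printing Implicit Defensive.

Declare Scope cat_scope.
Delimit Scope cat_scope with cat.
Local Open Scope cat_scope.

Reserved Notation "X ~> Y" (at level 90, right associativity).
Reserved Notation "g ∘ f" (at level 40, left associativity).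
Reserved Notation "X × Y" (at level 35, right associativity).
Reserved Notation "f ×m g" (at level 35, right associativity).
Reserved Notation "X ⊕ Y" (at level 36, right associativity).
Reserved Notation "f ⊕m g" (at level 36, right associativity).
Reserved Notation "⟨ f , g ⟩" (at level 0, f at level 99, g at level 99).
Reserved Notation "⟦ f , g ⟧" (at level 0, f at level 99, g at level 99).

Record Category : Type := {
  ob :> Type;
  hom : ob -> ob -> Type;
  id : forall X, hom X X;
  comp : forall X Y Z, hom Y Z -> hom X Y -> hom X Z;
  id_l : forall X Y (f : hom X Y), comp (id Y) f = f;
  id_r : forall X Y (f : hom X Y), comp f (id X) = f;
  comp_assoc : forall W X Y Z (h : hom Y Z) (g : hom X Y) (f : hom W X),
    comp h (comp g f) = comp (comp h g) f
}.
Arguments hom {_} X Y.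
Arguments id {_} X.
Arguments comp {_ X Y Z} g f.

Notation "X ~> Y" := (hom X Y) : cat_scope.
Notation "g ∘ f" := (comp g f) : cat_scope.

Section Universal.
Context {C : Category}.
Implicit Types A B S X Y Z W P Q : C.

Record is_coproduct {A B S} (i : A ~> S) (j : B ~> S) : Type := {
  cop_desc : forall Z, (A ~> Z) -> (B ~> Z) -> (S ~> Z);
  cop_desc_l : forall Z (f : A ~> Z) (g : B ~> Z), cop_desc f g ∘ i = f;
  cop_desc_r : forall Z (f : A ~> Z) (g : B ~> Z), cop_desc f g ∘ j = g;
  cop_desc_uniq : forall Z (f : A ~> Z) (g : B ~> Z) (h : S ~> Z),
    h ∘ i = f -> h ∘ j = g -> h = cop_desc f g
}.

Definition is_pullback {P X Y Z} (p : P ~> X) (q : P ~> Y)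
    (f : X ~> Z) (g : Y ~> Z) : Prop :=
  f ∘ p = g ∘ q /\
  forall W (u : W ~> X) (v : W ~> Y), f ∘ u = g ∘ v ->
    exists! w : W ~> P, p ∘ w = u /\ q ∘ w = v.

Definition is_coequalizer {X Y Q} (f g : X ~> Y) (q : Y ~> Q) : Prop :=
  q ∘ f = q ∘ g /\
  forall Z (h : Y ~> Z), h ∘ f = h ∘ g -> exists! k : Q ~> Z, k ∘ q = h.

Record Coequalizer {X Y} (f g : X ~> Y) : Type := {
  coeq_ob : C;
  coeq_map : Y ~> coeq_ob;
  coeq_eq : coeq_map ∘ f = coeq_map ∘ g;
  coeq_desc : forall Z (h : Y ~> Z), h ∘ f = h ∘ g -> (coeq_ob ~> Z);
  coeq_desc_map : forall Z (h : Y ~> Z) (e : h ∘ f = h ∘ g),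
    coeq_desc e ∘ coeq_map = h;
  coeq_desc_uniq : forall Z (h : Y ~> Z) (e : h ∘ f = h ∘ g) (k : coeq_ob ~> Z),
    k ∘ coeq_map = h -> k = coeq_desc e
}.

Lemma coeq_epi {X Y} {f g : X ~> Y} (Q : Coequalizer f g) Z
    (k k' : coeq_ob Q ~> Z) :
  k ∘ coeq_map Q = k' ∘ coeq_map Q -> k = k'.
Proof.
  intro e.
  assert (H : k' ∘ coeq_map Q ∘ f = k' ∘ coeq_map Q ∘ g).
  { rewrite <- !comp_assoc, coeq_eq; reflexivity. }
  rewrite (coeq_desc_uniq H e).
  symmetry; apply coeq_desc_uniq; reflexivity.
Qed.
End Universal.

Class FiniteProducts (C : Category) : Type := {
  one : C;
  bang : forall X : C, X ~> one;
  bang_uniq : forall (X : C) (f : X ~> one), f = bang X;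
  prod_ob : C -> C -> C;
  cfst : forall X Y : C, prod_ob X Y ~> X;
  csnd : forall X Y : C, prod_ob X Y ~> Y;
  pairing : forall Z X Y : C, (Z ~> X) -> (Z ~> Y) -> (Z ~> prod_ob X Y);
  pairing_fst : forall (Z X Y : C) (f : Z ~> X) (g : Z ~> Y),
    cfst X Y ∘ pairing f g = f;
  pairing_snd : forall (Z X Y : C) (f : Z ~> X) (g : Z ~> Y),
    csnd X Y ∘ pairing f g = g;
  pairing_uniq : forall (Z X Y : C) (f : Z ~> X) (g : Z ~> Y) (h : Z ~> prod_ob X Y),
    cfst X Y ∘ h = f -> csnd X Y ∘ h = g -> h = pairing f g
}.
Arguments cfst {_ _ X Y}.
Arguments csnd {_ _ X Y}.

Notation "X × Y" := (prod_ob X Y) : cat_scope.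
Notation "⟨ f , g ⟩" := (pairing f g) : cat_scope.

Definition prod_map {C : Category} {P : FiniteProducts C} {X X' Y Y' : C}
    (f : X ~> X') (g : Y ~> Y') : X × Y ~> X' × Y' :=
  ⟨ f ∘ cfst , g ∘ csnd ⟩.
Notation "f ×m g" := (prod_map f g) : cat_scope.

Class FiniteCoproducts (C : Category) : Type := {
  zero : C;
  cobang : forall X : C, zero ~> X;
  cobang_uniq : forall (X : C) (f : zero ~> X), f = cobang X;
  sum_ob : C -> C -> C;
  cinl : forall X Y : C, X ~> sum_ob X Y;
  cinr : forall X Y : C, Y ~> sum_ob X Y;
  sum_coproduct : forall X Y : C, is_coproduct (cinl X Y) (cinr X Y)
}.
Arguments cinl {_ _ X Y}.
Arguments cinr {_ _ X Y}.

Notation "X ⊕ Y" := (sum_ob X Y) : cat_scope.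

Definition copairing {C : Category} {S : FiniteCoproducts C} {X Y Z : C}
    (f : X ~> Z) (g : Y ~> Z) : X ⊕ Y ~> Z :=
  cop_desc (sum_coproduct X Y) f g.
Notation "⟦ f , g ⟧" := (copairing f g) : cat_scope.

Definition sum_map {C : Category} {S : FiniteCoproducts C} {X X' Y Y' : C}
    (f : X ~> X') (g : Y ~> Y') : X ⊕ Y ~> X' ⊕ Y' :=
  ⟦ cinl ∘ f , cinr ∘ g ⟧.
Notation "f ⊕m g" := (sum_map f g) : cat_scope.

(* Carboni, Lack and Walters: pullbacks along coproduct injections exist and,
   in a commutative diagram
     X --i--> Z <--j-- Y
     |f       |h       |g
     A -----> A+B <--- B
   the top row is a coproduct if and only if both squares are pullbacks. *)
Class Extensive (C : Category) {S : FiniteCoproducts C} : Type := {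
  ext_pb_inl : forall (A B Z : C) (h : Z ~> A ⊕ B),
    exists (P : C) (p : P ~> Z) (q : P ~> A), is_pullback p q h cinl;
  ext_pb_inr : forall (A B Z : C) (h : Z ~> A ⊕ B),
    exists (P : C) (p : P ~> Z) (q : P ~> B), is_pullback p q h cinr;
  ext_coproduct : forall (A B X Y Z : C) (f : X ~> A) (g : Y ~> B)
      (h : Z ~> A ⊕ B) (i : X ~> Z) (j : Y ~> Z),
    is_pullback i f h cinl -> is_pullback j g h cinr -> is_coproduct i j;
  ext_pullback : forall (A B X Y Z : C) (f : X ~> A) (g : Y ~> B)
      (h : Z ~> A ⊕ B) (i : X ~> Z) (j : Y ~> Z),
    h ∘ i = cinl ∘ f -> h ∘ j = cinr ∘ g -> is_coproduct i j ->
    is_pullback i f h cinl /\ is_pullback j g h cinr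
}.
Arguments Extensive C {S}.

(* Stability: for every X, the object X × N with the structure
   [⟨id, o !⟩, id × s] is the initial algebra of X + (-).
   The case X = 1 is the usual universal property of N. *)
Class StableNNO (C : Category) {P : FiniteProducts C} : Type := {
  nno : C;
  nzero : one ~> nno;
  nsucc : nno ~> nno;
  nrec : forall X Y : C, (X ~> Y) -> (Y ~> Y) -> (X × nno ~> Y);
  nrec_zero : forall (X Y : C) (f : X ~> Y) (g : Y ~> Y),
    nrec f g ∘ ⟨ id X , nzero ∘ bang X ⟩ = f;
  nrec_succ : forall (X Y : C) (f : X ~> Y) (g : Y ~> Y),
    nrec f g ∘ (id X ×m nsucc) = g ∘ nrec f g;
  nrec_uniq : forall (X Y : C) (f : X ~> Y) (g : Y ~> Y) (h : X × nno ~> Y),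
    h ∘ ⟨ id X , nzero ∘ bang X ⟩ = f -> h ∘ (id X ×m nsucc) = g ∘ h ->
    h = nrec f g
}.
Arguments StableNNO C {P}.

Class NatExponentials (C : Category) {P : FiniteProducts C} {N : StableNNO C} : Type := {
  npow : C -> C;
  neval : forall X : C, npow X × nno ~> X;
  ncurry : forall X Z : C, (Z × nno ~> X) -> (Z ~> npow X);
  ncurry_eval : forall (X Z : C) (f : Z × nno ~> X),
    neval X ∘ (ncurry f ×m id nno) = f;
  ncurry_uniq : forall (X Z : C) (f : Z × nno ~> X) (g : Z ~> npow X),
    neval X ∘ (g ×m id nno) = f -> g = ncurry f
}.
Arguments NatExponentials C {P N}.

Class DelayCoalgebras (C : Category) {S : FiniteCoproducts C} : Type := {
  delay : C -> C;
  out : forall X : C, delay X ~> X ⊕ delay X;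
  coit : forall X Z : C, (Z ~> X ⊕ Z) -> (Z ~> delay X);
  coit_out : forall (X Z : C) (c : Z ~> X ⊕ Z),
    out X ∘ coit c = (id X ⊕m coit c) ∘ c;
  coit_uniq : forall (X Z : C) (c : Z ~> X ⊕ Z) (h : Z ~> delay X),
    out X ∘ h = (id X ⊕m h) ∘ c -> h = coit c
}.
Arguments DelayCoalgebras C {S}.
Arguments out {C S _ X}.

Section Basics.
Context {C : Category} {P : FiniteProducts C} {S : FiniteCoproducts C}.
Implicit Types A B W X Y Z : C.

Lemma pairing_ext Z X Y (h k : Z ~> X × Y) :
  cfst ∘ h = cfst ∘ k -> csnd ∘ h = csnd ∘ k -> h = k.
Proof.
  intros e1 e2.
  rewrite (pairing_uniq e1 e2); symmetry; apply pairing_uniq; reflexivity.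
Qed.

Lemma pairing_comp W Z X Y (f : Z ~> X) (g : Z ~> Y) (h : W ~> Z) :
  ⟨ f , g ⟩ ∘ h = ⟨ f ∘ h , g ∘ h ⟩.
Proof.
  apply pairing_uniq; rewrite comp_assoc.
  - rewrite pairing_fst; reflexivity.
  - rewrite pairing_snd; reflexivity.
Qed.

Lemma prod_map_pairing Z X X' Y Y' (f : X ~> X') (g : Y ~> Y')
    (u : Z ~> X) (v : Z ~> Y) :
  (f ×m g) ∘ ⟨ u , v ⟩ = ⟨ f ∘ u , g ∘ v ⟩.
Proof.
  unfold prod_map; rewrite pairing_comp, <- !comp_assoc, pairing_fst, pairing_snd.
  reflexivity.
Qed.

Lemma prod_map_comp X X' X'' Y Y' Y'' (f : X ~> X') (f' : X' ~> X'')
    (g : Y ~> Y') (g' : Y' ~> Y'') :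
  (f' ×m g') ∘ (f ×m g) = (f' ∘ f) ×m (g' ∘ g).
Proof.
  unfold prod_map at 2; rewrite prod_map_pairing, !comp_assoc; reflexivity.
Qed.

Lemma copairing_l X Y Z (f : X ~> Z) (g : Y ~> Z) : ⟦ f , g ⟧ ∘ cinl = f.
Proof. apply cop_desc_l. Qed.

Lemma copairing_r X Y Z (f : X ~> Z) (g : Y ~> Z) : ⟦ f , g ⟧ ∘ cinr = g.
Proof. apply cop_desc_r. Qed.

Lemma copairing_uniq X Y Z (f : X ~> Z) (g : Y ~> Z) (h : X ⊕ Y ~> Z) :
  h ∘ cinl = f -> h ∘ cinr = g -> h = ⟦ f , g ⟧.
Proof. apply cop_desc_uniq. Qed.

Lemma copairing_eta X Y : ⟦ cinl , cinr ⟧ = id (X ⊕ Y).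
Proof. symmetry; apply copairing_uniq; apply id_l. Qed.

Lemma comp_copairing X Y Z W (f : X ~> Z) (g : Y ~> Z) (h : Z ~> W) :
  h ∘ ⟦ f , g ⟧ = ⟦ h ∘ f , h ∘ g ⟧.
Proof.
  apply copairing_uniq; rewrite <- comp_assoc.
  - rewrite copairing_l; reflexivity.
  - rewrite copairing_r; reflexivity.
Qed.

Lemma copairing_sum_map X X' Y Y' Z (f : X ~> X') (g : Y ~> Y')
    (u : X' ~> Z) (v : Y' ~> Z) :
  ⟦ u , v ⟧ ∘ (f ⊕m g) = ⟦ u ∘ f , v ∘ g ⟧.
Proof.
  unfold sum_map; rewrite comp_copairing, !comp_assoc, copairing_l, copairing_r.
  reflexivity.
Qed.

Lemma sum_map_comp X X' X'' Y Y' Y'' (f : X ~> X') (f' : X' ~> X'')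
    (g : Y ~> Y') (g' : Y' ~> Y'') :
  (f' ⊕m g') ∘ (f ⊕m g) = (f' ∘ f) ⊕m (g' ∘ g).
Proof.
  unfold sum_map at 1; rewrite copairing_sum_map, <- !comp_assoc; reflexivity.
Qed.

Lemma sum_map_id X Y : id X ⊕m id Y = id (X ⊕ Y).
Proof. unfold sum_map; rewrite !id_r; apply copairing_eta. Qed.
End Basics.

Section Distributivity.
Context {C : Category} {P : FiniteProducts C} {S : FiniteCoproducts C} {E : Extensive C}.
Implicit Types X Y Z : C.

Lemma prod_pullback X Y Z (i : Y ~> Z) :
  is_pullback (id X ×m i) (csnd : X × Y ~> Y) csnd i.
Proof.
  split.
  - unfold prod_map; apply pairing_snd.
  - intros W u v e. exists ⟨ cfst ∘ u , v ⟩; split.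
    + split; [| apply pairing_snd].
      rewrite prod_map_pairing, id_l.
      symmetry; apply pairing_uniq; [reflexivity | exact e].
    + intros w [e1 e2]; symmetry; apply pairing_uniq; [| exact e2].
      rewrite <- e1; unfold prod_map.
      rewrite comp_assoc, pairing_fst, id_l; reflexivity.
Qed.

Definition dstr_coproduct X Y Z :
    is_coproduct (id X ×m (cinl : Y ~> Y ⊕ Z)) (id X ×m (cinr : Z ~> Y ⊕ Z)) :=
  ext_coproduct (prod_pullback X cinl) (prod_pullback X cinr).

Definition dstr {X Y Z} : X × (Y ⊕ Z) ~> (X × Y) ⊕ (X × Z) :=
  cop_desc (dstr_coproduct X Y Z) cinl cinr.

Definition dstr_inv {X Y Z} : (X × Y) ⊕ (X × Z) ~> X × (Y ⊕ Z) :=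
  ⟦ id X ×m cinl , id X ×m cinr ⟧.

Lemma dstrK X Y Z : dstr_inv ∘ dstr = id (X × (Y ⊕ Z)).
Proof.
  transitivity (cop_desc (dstr_coproduct X Y Z) (id X ×m cinl) (id X ×m cinr)).
  - apply cop_desc_uniq; unfold dstr, dstr_inv; rewrite <- comp_assoc.
    + rewrite cop_desc_l; apply copairing_l.
    + rewrite cop_desc_r; apply copairing_r.
  - symmetry; apply cop_desc_uniq; apply id_l.
Qed.

Lemma dstr_invK X Y Z : dstr ∘ dstr_inv = id ((X × Y) ⊕ (X × Z)).
Proof.
  unfold dstr_inv; rewrite comp_copairing; unfold dstr.
  rewrite cop_desc_l, cop_desc_r; apply copairing_eta.
Qed.
End Distributivity.

Section Delay.
Context {C : Category} {S : FiniteCoproducts C} {D : DelayCoalgebras C}.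
Implicit Types X Y Z W : C.

Definition out_inv {X} : X ⊕ delay X ~> delay X := coit (id X ⊕m out).

Lemma coit_out_id X : coit out = id (delay X).
Proof. symmetry; apply coit_uniq; rewrite id_r, sum_map_id, id_l; reflexivity. Qed.

Lemma out_invK X : out_inv ∘ out = id (delay X).
Proof.
  rewrite <- coit_out_id; apply coit_uniq.
  unfold out_inv at 1; rewrite comp_assoc, coit_out, sum_map_comp, id_l.
  reflexivity.
Qed.

Lemma outK X : out ∘ out_inv = id (X ⊕ delay X).
Proof.
  unfold out_inv at 1; rewrite coit_out, sum_map_comp, id_l.
  fold (@out_inv X); rewrite out_invK; apply sum_map_id.
Qed.

Definition now {X} : X ~> delay X := out_inv ∘ cinl.
Definition later {X} : delay X ~> delay X := out_inv ∘ cinr.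

Lemma out_now X : out ∘ now = (cinl : X ~> X ⊕ delay X).
Proof. unfold now; rewrite comp_assoc, outK; apply id_l. Qed.

Lemma out_later X : out ∘ later = (cinr : delay X ~> X ⊕ delay X).
Proof. unfold later; rewrite comp_assoc, outK; apply id_l. Qed.

Lemma out_mono X Z (f g : Z ~> delay X) : out ∘ f = out ∘ g -> f = g.
Proof.
  intro e.
  rewrite <- (id_l f), <- (id_l g), <- out_invK, <- !comp_assoc, e; reflexivity.
Qed.

Definition kl_coalg {X Y} (f : X ~> delay Y) :
    delay X ⊕ delay Y ~> Y ⊕ (delay X ⊕ delay Y) :=
  ⟦ ⟦ (id Y ⊕m cinr) ∘ out ∘ f , cinr ∘ cinl ⟧ ∘ out , (id Y ⊕m cinr) ∘ out ⟧.

(* The Kleisli lifting f^*, characterized by kl_out and kl_uniq. *)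
Definition kl {X Y} (f : X ~> delay Y) : delay X ~> delay Y :=
  coit (kl_coalg f) ∘ cinl.

Lemma kl_out X Y (f : X ~> delay Y) : out ∘ kl f = ⟦ out ∘ f , cinr ∘ kl f ⟧ ∘ out.
Proof.
  assert (Hr : coit (kl_coalg f) ∘ cinr = id (delay Y)).
  { rewrite <- coit_out_id; apply coit_uniq.
    rewrite comp_assoc, coit_out, <- comp_assoc; unfold kl_coalg at 2.
    rewrite copairing_r, comp_assoc, sum_map_comp, id_l; reflexivity. }
  unfold kl at 1; rewrite comp_assoc, coit_out, <- comp_assoc.
  unfold kl_coalg at 2; rewrite copairing_l, comp_assoc, comp_copairing.
  rewrite !comp_assoc, sum_map_comp, Hr, id_l, sum_map_id, id_l.
  unfold sum_map; rewrite copairing_r, <- comp_assoc; reflexivity.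
Qed.

Lemma kl_uniq X Y (f : X ~> delay Y) (h : delay X ~> delay Y) :
  out ∘ h = ⟦ out ∘ f , cinr ∘ h ⟧ ∘ out -> h = kl f.
Proof.
  intro e; unfold kl.
  rewrite <- (coit_uniq (c := kl_coalg f) (h := ⟦ h , id _ ⟧)).
  - rewrite copairing_l; reflexivity.
  - rewrite comp_copairing, e; unfold kl_coalg; rewrite comp_copairing.
    f_equal.
    + rewrite comp_assoc, comp_copairing, !comp_assoc, sum_map_comp, copairing_r.
      rewrite id_l, sum_map_id, id_l; unfold sum_map.
      rewrite copairing_r, <- comp_assoc, copairing_l; reflexivity.
    + rewrite comp_assoc, sum_map_comp, copairing_r, id_l, sum_map_id, id_l, id_r.
      reflexivity.
Qed.

Lemma kl_now X Y (f : X ~> delay Y) : kl f ∘ now = f.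
Proof.
  apply out_mono; rewrite comp_assoc, kl_out, <- comp_assoc, out_now.
  apply copairing_l.
Qed.

Lemma kl_later X Y (f : X ~> delay Y) : kl f ∘ later = later ∘ kl f.
Proof.
  apply out_mono; rewrite !comp_assoc, out_later, kl_out, <- comp_assoc, out_later.
  apply copairing_r.
Qed.

Lemma kl_id X : kl now = id (delay X).
Proof.
  symmetry; apply kl_uniq.
  rewrite out_now, !id_r, copairing_eta, id_l; reflexivity.
Qed.

Lemma kl_kl X Y Z (f : X ~> delay Y) (g : Y ~> delay Z) :
  kl (kl g ∘ f) = kl g ∘ kl f.
Proof.
  symmetry; apply kl_uniq.
  rewrite !comp_assoc, kl_out, <- comp_assoc, kl_out.
  rewrite comp_assoc, comp_copairing, !comp_assoc, copairing_r; reflexivity.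
Qed.

Definition dmap {X Y} (f : X ~> Y) : delay X ~> delay Y := kl (now ∘ f).

Lemma dmap_id X : dmap (id X) = id (delay X).
Proof. unfold dmap; rewrite id_r; apply kl_id. Qed.

Lemma dmap_comp X Y Z (g : Y ~> Z) (f : X ~> Y) : dmap (g ∘ f) = dmap g ∘ dmap f.
Proof.
  unfold dmap; rewrite <- kl_kl, !comp_assoc, kl_now; reflexivity.
Qed.

Definition dmult {X} : delay (delay X) ~> delay X := kl (id (delay X)).

Context {P : FiniteProducts C} {E : Extensive C}.

Definition dstrength {X Y} : X × delay Y ~> delay (X × Y) :=
  coit (dstr ∘ (id X ×m out)).

Context {N : StableNNO C}.

Definition iota (X : C) : X × nno ~> delay X := nrec now later.

Lemma iota_nat X Y (f : X ~> Y) : dmap f ∘ iota X = iota Y ∘ (f ×m id nno).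
Proof.
  transitivity (nrec (now ∘ f) (later (X := Y))).
  - apply nrec_uniq; rewrite <- comp_assoc; unfold iota.
    + rewrite nrec_zero; apply kl_now.
    + rewrite nrec_succ, !comp_assoc; unfold dmap; rewrite kl_later; reflexivity.
  - symmetry; apply nrec_uniq; rewrite <- comp_assoc; unfold iota.
    + transitivity (iota Y ∘ (⟨ id Y , nzero ∘ bang Y ⟩ ∘ f)).
      * unfold iota; f_equal; rewrite prod_map_pairing, pairing_comp, id_l, id_l, id_r.
        rewrite <- comp_assoc, (bang_uniq (bang Y ∘ f)); reflexivity.
      * rewrite comp_assoc; unfold iota; rewrite nrec_zero; reflexivity.
    + rewrite prod_map_comp, id_l, id_r.
      replace (f ×m nsucc) with ((id Y ×m nsucc) ∘ (f ×m id nno)).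
      * rewrite comp_assoc, nrec_succ, <- comp_assoc; reflexivity.
      * rewrite prod_map_comp, id_l, id_r; reflexivity.
Qed.
End Delay.

Record Functor (C : Category) : Type := {
  fob :> C -> C;
  fmap : forall X Y : C, (X ~> Y) -> (fob X ~> fob Y);
  fmap_id : forall X : C, fmap (id X) = id (fob X);
  fmap_comp : forall (X Y Z : C) (g : Y ~> Z) (f : X ~> Y),
    fmap (g ∘ f) = fmap g ∘ fmap f
}.
Arguments fmap {C} F {X Y} f : rename.

Definition delay_functor {C : Category} {S : FiniteCoproducts C}
    {D : DelayCoalgebras C} : Functor C :=
  {| fob := delay; fmap := @dmap C S D;
     fmap_id := @dmap_id C S D; fmap_comp := @dmap_comp C S D |}.

Section StrongMonads.
Context {C : Category} {P : FiniteProducts C}.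
Implicit Types X Y Z : C.

Definition passoc {X Y Z} : (X × Y) × Z ~> X × (Y × Z) :=
  ⟨ cfst ∘ cfst , ⟨ csnd ∘ cfst , csnd ⟩ ⟩.

Record StrongMonadData (T : Functor C) : Type := {
  munit : forall X, X ~> T X;
  mmult : forall X, T (T X) ~> T X;
  mstr : forall X Y, X × T Y ~> T (X × Y)
}.

Record is_strong_monad (T : Functor C) (M : StrongMonadData T) : Prop := {
  munit_nat : forall X Y (f : X ~> Y), fmap T f ∘ munit M X = munit M Y ∘ f;
  mmult_nat : forall X Y (f : X ~> Y),
    fmap T f ∘ mmult M X = mmult M Y ∘ fmap T (fmap T f);
  mmult_unit_l : forall X, mmult M X ∘ munit M (T X) = id (T X);
  mmult_unit_r : forall X, mmult M X ∘ fmap T (munit M X) = id (T X);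
  mmult_assoc : forall X, mmult M X ∘ mmult M (T X) = mmult M X ∘ fmap T (mmult M X);
  mstr_nat : forall X X' Y Y' (f : X ~> X') (g : Y ~> Y'),
    fmap T (f ×m g) ∘ mstr M X Y = mstr M X' Y' ∘ (f ×m fmap T g);
  mstr_one : forall X, fmap T csnd ∘ mstr M one X = csnd;
  mstr_assoc : forall X Y Z,
    fmap T passoc ∘ mstr M (X × Y) Z
      = mstr M X (Y × Z) ∘ (id X ×m mstr M Y Z) ∘ passoc;
  mstr_unit : forall X Y, mstr M X Y ∘ (id X ×m munit M Y) = munit M (X × Y);
  mstr_mult : forall X Y,
    mstr M X Y ∘ (id X ×m mmult M Y)
      = mmult M (X × Y) ∘ fmap T (mstr M X Y) ∘ mstr M X (T Y)
}.

Record is_strong_monad_morphism (T T' : Functor C) (M : StrongMonadData T)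
    (M' : StrongMonadData T') (r : forall X, T X ~> T' X) : Prop := {
  mmor_nat : forall X Y (f : X ~> Y), fmap T' f ∘ r X = r Y ∘ fmap T f;
  mmor_unit : forall X, r X ∘ munit M X = munit M' X;
  mmor_mult : forall X, r X ∘ mmult M X = mmult M' X ∘ fmap T' (r X) ∘ r (T X);
  mmor_str : forall X Y, r (X × Y) ∘ mstr M X Y = mstr M' X Y ∘ (id X ×m r Y)
}.
End StrongMonads.

Definition delay_monad {C : Category} {P : FiniteProducts C}
    {S : FiniteCoproducts C} {E : Extensive C} {D : DelayCoalgebras C} :
    StrongMonadData delay_functor :=
  {| munit := @now C S D : forall X, X ~> delay_functor X;
     mmult := @dmult C S D : forall X, delay_functor (delay_functor X) ~> delay_functor X;
     mstr := @dstrength C S D P E : forall X Y, X × delay_functor Y ~> delay_functor (X × Y) |}.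

Section Algebras.
Context {C : Category} {S : FiniteCoproducts C}.
Implicit Types A B W X Y Z : C.

Definition is_search_algebra {D : DelayCoalgebras C} {A} (a : delay A ~> A) : Prop :=
  a ∘ now = id A /\ a ∘ later = a.

Definition is_dalg_morphism {D : DelayCoalgebras C} {A B}
    (a : delay A ~> A) (b : delay B ~> B) (h : A ~> B) : Prop :=
  h ∘ a = b ∘ dmap h.

Record Elgot (A : C) : Type := {
  dag : forall Z, (Z ~> A ⊕ Z) -> (Z ~> A);
  dag_fixpoint : forall Z (f : Z ~> A ⊕ Z), dag f = ⟦ id A , dag f ⟧ ∘ f;
  dag_uniformity : forall Y Z (f : Z ~> A ⊕ Z) (g : Y ~> A ⊕ Y) (h : Z ~> Y),
    (id A ⊕m h) ∘ f = g ∘ h -> dag f = dag g ∘ h;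
  dag_compositionality : forall X Y (f : X ~> A ⊕ X) (h : Y ~> X ⊕ Y),
    dag ((dag f ⊕m id Y) ∘ h)
      = dag (⟦ (id A ⊕m cinl) ∘ f , cinr ∘ cinr ⟧ ∘ ⟦ cinl , h ⟧) ∘ cinr
}.

Context {P : FiniteProducts C} {E : Extensive C}.

Definition right_iteration_preserving {W A B} (EA : Elgot A) (EB : Elgot B)
    (g : W × A ~> B) : Prop :=
  forall Z (h : Z ~> A ⊕ Z),
    g ∘ (id W ×m dag EA h) = dag EB ((g ⊕m id (W × Z)) ∘ dstr ∘ (id W ×m h)).

Definition is_stable_free_elgot {X F} (EF : Elgot F) (u : X ~> F) : Prop :=
  forall W A (EA : Elgot A) (f : W × X ~> A),
    exists! f' : W × F ~> A,
      right_iteration_preserving EF EA f' /\ f = f' ∘ (id W ×m u).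
End Algebras.

Section Quotient.
Context {C : Category} {P : FiniteProducts C} {S : FiniteCoproducts C}
  {N : StableNNO C} {D : DelayCoalgebras C}.
Context (Q : forall X : C, Coequalizer (kl (iota X)) (dmap (cfst : X × nno ~> X))).

Definition qdelay (X : C) : C := coeq_ob (Q X).
Definition rho (X : C) : delay X ~> qdelay X := coeq_map (Q X).

Lemma qmap_eq X Y (f : X ~> Y) :
  rho Y ∘ dmap f ∘ kl (iota X) = rho Y ∘ dmap f ∘ dmap cfst.
Proof.
  assert (H1 : dmap f ∘ kl (iota X) = kl (iota Y) ∘ dmap (f ×m id nno)).
  { unfold dmap; rewrite <- !kl_kl, comp_assoc, kl_now.
    fold (dmap f); rewrite iota_nat; reflexivity. }
  assert (H2 : dmap f ∘ dmap (cfst : X × nno ~> X) = dmap cfst ∘ dmap (f ×m id nno)).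
  { rewrite <- !dmap_comp; unfold prod_map; rewrite pairing_fst; reflexivity. }
  rewrite <- !comp_assoc, H1, H2, !comp_assoc.
  unfold rho, qdelay; rewrite coeq_eq; reflexivity.
Qed.

(* The action making rho natural; it is determined by qmap_rho. *)
Definition qmap {X Y} (f : X ~> Y) : qdelay X ~> qdelay Y := coeq_desc (Q X) (qmap_eq f).

Lemma qmap_rho X Y (f : X ~> Y) : qmap f ∘ rho X = rho Y ∘ dmap f.
Proof. apply coeq_desc_map. Qed.

Lemma qmap_id X : qmap (id X) = id (qdelay X).
Proof.
  apply (coeq_epi (Q := Q X)); fold (rho X) (qdelay X).
  rewrite qmap_rho, dmap_id, id_l, id_r; reflexivity.
Qed.

Lemma qmap_comp X Y Z (g : Y ~> Z) (f : X ~> Y) : qmap (g ∘ f) = qmap g ∘ qmap f.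
Proof.
  apply (coeq_epi (Q := Q X)); fold (rho X) (qdelay X).
  rewrite <- comp_assoc, !qmap_rho, comp_assoc, qmap_rho, dmap_comp, comp_assoc.
  reflexivity.
Qed.

Definition qdelay_functor : Functor C :=
  {| fob := qdelay; fmap := @qmap; fmap_id := qmap_id; fmap_comp := qmap_comp |}.
End Quotient.

(* Main.v *)
(* Write [Dt X] for the quotient of [delay X] and consider the map [const_delay : A × DA -> DA]
   which overwrites the result of a computation by a given value.  If [a] is a search-algebra
   structure on [A], then [const_delay ∘ ⟨a, id⟩ = id]: a terminating computation [d] has value
   [a d].  So [DA] is a retract of [A × DA], and since [rho × id] is epic and
   [const_delay ∘ (rho × id)] factors through [D rho], the map [D rho] (likewise [W × D rho] and
   [DD rho]) is epic under (2).  Equations on [D Dt X] can then be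
   checked on [DD X]: this makes the structure map of (2) an Eilenberg-Moore algebra, hence an Elgot
   algebra with [dag f = alpha ∘ coit f], and yields freeness in (3) and the monad laws in (4).
   Preservation of the coequalizer uses the same retraction: for [h : DDX -> Z] coequalizing the
   [D]-images, the factorization is built from [h ∘ const_delay], and the discrepancy between
   [later^n (now d)] and [later^n (now (later^n d))] is absorbed by [h] after counting the [n]
   outer steps. *)
Require Import Defs.
From Stdlib Require Import ClassicalEpsilon.

Set Implicit Arguments.
Unset Strict Implicit.
Local Open Scope cat_scope.

(** * Products, coproducts and distributivity: equational toolkit *)

Section Basics.
Context {C : Category} {P : FiniteProducts C} {S : FiniteCoproducts C}.
Implicit Types A B W X Y Z : C.

Definition epic {X Y} (q : X ~> Y) : Prop :=
  forall Z (h k : Y ~> Z), h ∘ q = k ∘ q -> h = k.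

Lemma coequalizer_epic X Y A (f g : X ~> Y) (q : Y ~> A) :
  is_coequalizer f g q -> epic q.
Proof.
  intros [e u] Z h k ehk.
  destruct (u Z (k ∘ q)) as [m [_ um]].
  - now rewrite <- !comp_assoc, e.
  - now rewrite <- (um h ehk), <- (um k eq_refl).
Qed.

Lemma bang_comp X Y (f : X ~> Y) : bang Y ∘ f = bang X.
Proof. apply bang_uniq. Qed.

Lemma pairing_eta X Y : ⟨ cfst , csnd ⟩ = id (X × Y).
Proof. symmetry; apply pairing_uniq; apply id_r. Qed.

Lemma pairing_eta_comp X Y Z (f : Z ~> X × Y) : ⟨ cfst ∘ f , csnd ∘ f ⟩ = f.
Proof. symmetry; now apply pairing_uniq. Qed.

Lemma copairing_l_comp W X Y Z (f : X ~> Z) (g : Y ~> Z) (h : W ~> X) :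
  ⟦ f , g ⟧ ∘ (cinl ∘ h) = f ∘ h.
Proof. now rewrite comp_assoc, copairing_l. Qed.

Lemma sum_ext X Y Z (h k : X ⊕ Y ~> Z) :
  h ∘ cinl = k ∘ cinl -> h ∘ cinr = k ∘ cinr -> h = k.
Proof. intros e1 e2; rewrite (copairing_uniq e1 e2); symmetry; now apply copairing_uniq. Qed.

Lemma sum_map_l X X' Y Y' (f : X ~> X') (g : Y ~> Y') : (f ⊕m g) ∘ cinl = cinl ∘ f.
Proof. apply copairing_l. Qed.

Lemma sum_map_r X X' Y Y' (f : X ~> X') (g : Y ~> Y') : (f ⊕m g) ∘ cinr = cinr ∘ g.
Proof. apply copairing_r. Qed.

Lemma sum_map_l_comp W X X' Y Y' (f : X ~> X') (g : Y ~> Y') (h : W ~> X) :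
  (f ⊕m g) ∘ (cinl ∘ h) = cinl ∘ (f ∘ h).
Proof. now rewrite comp_assoc, sum_map_l, comp_assoc. Qed.

Lemma sum_map_r_comp W X X' Y Y' (f : X ~> X') (g : Y ~> Y') (h : W ~> Y) :
  (f ⊕m g) ∘ (cinr ∘ h) = cinr ∘ (g ∘ h).
Proof. now rewrite comp_assoc, sum_map_r, comp_assoc. Qed.

Context {E : Extensive C}.

Lemma dstr_l X Y Z : dstr ∘ (id X ×m (cinl : Y ~> Y ⊕ Z)) = cinl.
Proof. apply cop_desc_l. Qed.

Lemma dstr_r X Y Z : dstr ∘ (id X ×m (cinr : Z ~> Y ⊕ Z)) = cinr.
Proof. apply cop_desc_r. Qed.

Lemma dstr_pairing_l W X Y Z (f : W ~> X) (g : W ~> Y) :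
  dstr ∘ ⟨ f , (cinl : Y ~> Y ⊕ Z) ∘ g ⟩ = cinl ∘ ⟨ f , g ⟩.
Proof.
  rewrite <- dstr_l, <- comp_assoc, prod_map_pairing, id_l; reflexivity.
Qed.

Lemma dstr_pairing_r W X Y Z (f : W ~> X) (g : W ~> Z) :
  dstr ∘ ⟨ f , (cinr : Z ~> Y ⊕ Z) ∘ g ⟩ = cinr ∘ ⟨ f , g ⟩.
Proof.
  rewrite <- dstr_r, <- comp_assoc, prod_map_pairing, id_l; reflexivity.
Qed.

Lemma prod_sum_ext X Y Z W (h k : X × (Y ⊕ Z) ~> W) :
  h ∘ (id X ×m cinl) = k ∘ (id X ×m cinl) ->
  h ∘ (id X ×m cinr) = k ∘ (id X ×m cinr) -> h = k.
Proof.
  intros e1 e2.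
  rewrite (cop_desc_uniq (dstr_coproduct X Y Z) e1 e2).
  symmetry; now apply cop_desc_uniq.
Qed.
End Basics.

#[local] Hint Rewrite <- @comp_assoc : cat.
#[local] Hint Rewrite @id_l @id_r @pairing_fst @pairing_snd @pairing_comp
  @pairing_eta @bang_comp @pairing_eta_comp
  @copairing_l @copairing_r @copairing_l_comp
  @sum_map_l @sum_map_r @sum_map_l_comp @sum_map_r_comp
  @dstr_pairing_l @dstr_pairing_r : cat.

Ltac cat := unfold prod_map; autorewrite with cat.
Ltac cat_in H := unfold prod_map in H; autorewrite with cat in H.

(** * Computation rules for the delay monad *)

Section Delay.
Context {C : Category} {P : FiniteProducts C} {S : FiniteCoproducts C}
  {E : Extensive C} {D : DelayCoalgebras C}.
Implicit Types A B W X Y Z : C.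

Lemma kl_now_comp W X Y (f : X ~> delay Y) (g : W ~> X) : kl f ∘ (now ∘ g) = f ∘ g.
Proof. now rewrite comp_assoc, kl_now. Qed.

Lemma kl_later_comp W X Y (f : X ~> delay Y) (g : W ~> delay X) :
  kl f ∘ (later ∘ g) = later ∘ (kl f ∘ g).
Proof. now rewrite comp_assoc, kl_later, comp_assoc. Qed.

Lemma out_now_comp W X (g : W ~> X) : out ∘ (now ∘ g) = cinl ∘ g.
Proof. now rewrite comp_assoc, out_now. Qed.

Lemma out_later_comp W X (g : W ~> delay X) : out ∘ (later ∘ g) = cinr ∘ g.
Proof. now rewrite comp_assoc, out_later. Qed.

Lemma dmap_now X Y (f : X ~> Y) : dmap f ∘ now = now ∘ f.
Proof. apply kl_now. Qed.

Lemma dmap_later X Y (f : X ~> Y) : dmap f ∘ later = later ∘ dmap f.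
Proof. apply kl_later. Qed.

Lemma dmap_now_comp W X Y (f : X ~> Y) (g : W ~> X) : dmap f ∘ (now ∘ g) = now ∘ (f ∘ g).
Proof. unfold dmap; now rewrite kl_now_comp, comp_assoc. Qed.

Lemma dmap_later_comp W X Y (f : X ~> Y) (g : W ~> delay X) :
  dmap f ∘ (later ∘ g) = later ∘ (dmap f ∘ g).
Proof. apply kl_later_comp. Qed.

Lemma dmult_now X : dmult ∘ now = id (delay X).
Proof. apply kl_now. Qed.

Lemma dmult_later X : (dmult : delay (delay X) ~> delay X) ∘ later = later ∘ dmult.
Proof. apply kl_later. Qed.

Lemma dmult_now_comp W X (g : W ~> delay X) : dmult ∘ (now ∘ g) = g.
Proof. now rewrite comp_assoc, dmult_now, id_l. Qed.

Lemma dmult_later_comp W X (g : W ~> delay (delay X)) :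
  dmult ∘ (later ∘ g) = later ∘ (dmult ∘ g).
Proof. apply kl_later_comp. Qed.

(** [out_inv] is invertible, so [now] and [later] exhibit [delay X] as a coproduct. *)
Lemma delay_ext X Z (h k : delay X ~> Z) :
  h ∘ now = k ∘ now -> h ∘ later = k ∘ later -> h = k.
Proof.
  intros e1 e2.
  rewrite <- (id_r h), <- (id_r k), <- (out_invK X), !comp_assoc; f_equal.
  apply sum_ext; rewrite <- !comp_assoc; assumption.
Qed.

Lemma prod_delay_ext W X Z (h k : W × delay X ~> Z) :
  h ∘ (id W ×m now) = k ∘ (id W ×m now) ->
  h ∘ (id W ×m later) = k ∘ (id W ×m later) -> h = k.
Proof.
  intros e1 e2.
  assert (H : (id W ×m out_inv) ∘ (id W ×m out) = id (W × delay X)).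
  { now rewrite prod_map_comp, out_invK, id_l; cat. }
  rewrite <- (id_r h), <- (id_r k), <- H, !comp_assoc; f_equal.
  apply prod_sum_ext; rewrite <- !comp_assoc, !prod_map_comp, id_l; assumption.
Qed.
End Delay.

#[local] Hint Rewrite @kl_now @kl_later @kl_now_comp @kl_later_comp @out_now @out_later
  @out_now_comp @out_later_comp @dmap_now @dmap_later @dmap_now_comp @dmap_later_comp
  @dmult_now @dmult_later @dmult_now_comp @dmult_later_comp : cat.

(** * Uniqueness principles from finality of [delay] *)

Section Coinduction.
Context {C : Category} {P : FiniteProducts C} {S : FiniteCoproducts C}
  {E : Extensive C} {D : DelayCoalgebras C}.
Implicit Types A B W X Y Z : C.

(** Both maps solve the guarded equation whose only solution is [kl (h ∘ now)]. *)
Lemma delay_unique X Y (h k : delay X ~> delay Y) :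
  h ∘ now = k ∘ now -> h ∘ later = later ∘ h -> k ∘ later = later ∘ k -> h = k.
Proof.
  intros e eh ek.
  transitivity (kl (h ∘ now)); [| symmetry]; apply kl_uniq; apply delay_ext; cat.
  - reflexivity.
  - now rewrite eh; cat.
  - now rewrite e.
  - now rewrite ek; cat.
Qed.

(** The parameter may change through [t] at every step: [t := id W] gives the strength laws,
    [t := nsucc] serves for counting. *)
Lemma parametric_delay_unique W X Y (t : W ~> W) (h k : W × delay X ~> delay Y) :
  h ∘ (id W ×m now) = k ∘ (id W ×m now) ->
  h ∘ (id W ×m later) = later ∘ h ∘ (t ×m id (delay X)) ->
  k ∘ (id W ×m later) = later ∘ k ∘ (t ×m id (delay X)) ->
  h = k.
Proof.
  intros e eh ek.
  (* A state of [c] is either a pending pair or a computation in [delay Y] that takes over once the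
     first one returns. Only the values of [h] on [now] enter [c], and [k] shares them. *)
  pose (c := ⟦ ⟦ (id Y ⊕m cinr) ∘ out ∘ (h ∘ (id W ×m now)) ,
                 cinr ∘ cinl ∘ (t ×m id (delay X)) ⟧ ∘ dstr ∘ (id W ×m out) ,
               (id Y ⊕m cinr) ∘ out ⟧).
  assert (H : forall l : W × delay X ~> delay Y,
    l ∘ (id W ×m now) = h ∘ (id W ×m now) ->
    l ∘ (id W ×m later) = later ∘ l ∘ (t ×m id (delay X)) ->
    ⟦ l , id (delay Y) ⟧ = coit c).
  { intros l e1 e2; cat_in e1; cat_in e2; apply coit_uniq; unfold c.
    clear c eh ek e; apply sum_ext.
    - apply prod_delay_ext; cat.
      + rewrite e1; generalize (out ∘ (h ∘ ⟨ cfst , now ∘ csnd ⟩)).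
        intro m; rewrite (comp_assoc (id Y ⊕m ⟦ l , id _ ⟧)), sum_map_comp; cat.
        now rewrite sum_map_id, id_l.
      + now rewrite e2; cat.
    - cat. rewrite (comp_assoc (id Y ⊕m ⟦ l , id _ ⟧)), sum_map_comp; cat.
      now rewrite sum_map_id, id_l. }
  rewrite <- (copairing_l h (id (delay Y))), <- (copairing_l k (id (delay Y))).
  now rewrite (H h), (H k).
Qed.

Lemma dstrength_now X Y : dstrength ∘ (id X ×m now) = (now : X × Y ~> _).
Proof. apply out_mono; unfold dstrength; rewrite comp_assoc, coit_out; cat; reflexivity. Qed.

Lemma dstrength_later X Y :
  dstrength ∘ (id X ×m later) = later ∘ (dstrength : X × delay Y ~> _).
Proof. apply out_mono; unfold dstrength; rewrite comp_assoc, coit_out; cat; reflexivity. Qed.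

Lemma dstrength_pairing_now W X Y (f : W ~> X) (g : W ~> Y) :
  dstrength ∘ ⟨ f , now ∘ g ⟩ = now ∘ ⟨ f , g ⟩.
Proof. rewrite <- dstrength_now, <- comp_assoc, prod_map_pairing, id_l; reflexivity. Qed.

Lemma dstrength_pairing_now_id X Y (f : Y ~> X) :
  dstrength ∘ ⟨ f , now ⟩ = now ∘ ⟨ f , id Y ⟩.
Proof. now rewrite <- dstrength_pairing_now, id_r. Qed.

Lemma dstrength_pairing_later W X Y (f : W ~> X) (g : W ~> delay Y) :
  dstrength ∘ ⟨ f , later ∘ g ⟩ = later ∘ (dstrength ∘ ⟨ f , g ⟩).
Proof.
  rewrite comp_assoc, <- dstrength_later, <- comp_assoc, prod_map_pairing, id_l.
  reflexivity.
Qed.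

Lemma dstrength_pairing_later_id X Y (f : delay Y ~> X) :
  dstrength ∘ ⟨ f , later ⟩ = later ∘ (dstrength ∘ ⟨ f , id (delay Y) ⟩).
Proof. now rewrite <- dstrength_pairing_later, id_r. Qed.
End Coinduction.

#[local] Hint Rewrite @dstrength_pairing_now @dstrength_pairing_now_id
  @dstrength_pairing_later @dstrength_pairing_later_id : cat.

(** * Laws of the strong delay monad, and unfoldings of composite coalgebras *)

Section Strength.
Context {C : Category} {P : FiniteProducts C} {S : FiniteCoproducts C}
  {E : Extensive C} {D : DelayCoalgebras C}.
Implicit Types A B W X Y Z : C.

Lemma strong_delay_unique W X Y (h k : W × delay X ~> delay Y) :
  h ∘ (id W ×m now) = k ∘ (id W ×m now) ->
  h ∘ (id W ×m later) = later ∘ h -> k ∘ (id W ×m later) = later ∘ k -> h = k.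
Proof.
  intros e eh ek; apply parametric_delay_unique with (t := id W); [exact e | |].
  - rewrite eh; cat; reflexivity.
  - rewrite ek; cat; reflexivity.
Qed.

Lemma kl_dmap X Y Z (f : X ~> Y) (g : Y ~> delay Z) : kl g ∘ dmap f = kl (g ∘ f).
Proof. apply delay_unique; cat; reflexivity. Qed.

Lemma dmap_kl X Y Z (f : X ~> delay Y) (g : Y ~> Z) : dmap g ∘ kl f = kl (dmap g ∘ f).
Proof. apply delay_unique; cat; reflexivity. Qed.

Lemma dmult_dmap X Y (f : X ~> delay Y) : dmult ∘ dmap f = kl f.
Proof. apply delay_unique; cat; reflexivity. Qed.

Lemma dmap_dmult X Y (f : X ~> Y) : dmap f ∘ dmult = dmult ∘ dmap (dmap f).
Proof. apply delay_unique; cat; reflexivity. Qed.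

Lemma dmult_dmult X : dmult ∘ dmult = dmult ∘ dmap (dmult : delay (delay X) ~> _).
Proof. apply delay_unique; cat; reflexivity. Qed.

Lemma kl_now_later X : kl (later ∘ now) = (later : delay X ~> _).
Proof. apply delay_unique; cat; reflexivity. Qed.

Lemma dstrength_nat X X' Y Y' (f : X ~> X') (g : Y ~> Y') :
  dmap (f ×m g) ∘ dstrength = dstrength ∘ (f ×m dmap g).
Proof. apply strong_delay_unique; cat; reflexivity. Qed.

Lemma dstrength_snd X Y : dmap csnd ∘ dstrength = (csnd : X × delay Y ~> _).
Proof. apply strong_delay_unique; cat; reflexivity. Qed.

Lemma dstrength_assoc X Y Z :
  dmap passoc ∘ (dstrength : (X × Y) × delay Z ~> _)
    = dstrength ∘ (id X ×m dstrength) ∘ passoc.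
Proof. apply strong_delay_unique; unfold passoc; cat; reflexivity. Qed.

Lemma dstrength_kl X Y Z (f : Y ~> delay Z) :
  dstrength ∘ (id X ×m kl f) = kl (dstrength ∘ (id X ×m f)) ∘ dstrength.
Proof. apply strong_delay_unique; cat; reflexivity. Qed.

Lemma dstrength_dmult X Y :
  dstrength ∘ (id X ×m dmult) = dmult ∘ dmap dstrength ∘ (dstrength : X × delay (delay Y) ~> _).
Proof. apply strong_delay_unique; cat; reflexivity. Qed.

Lemma out_dmap X Y (f : X ~> Y) : out ∘ dmap f = (f ⊕m dmap f) ∘ out.
Proof. apply delay_ext; cat; reflexivity. Qed.

Lemma dstr_sum_map W A Z Z' (f : Z ~> Z') :
  dstr ∘ (id W ×m (id A ⊕m f)) = (id (W × A) ⊕m (id W ×m f)) ∘ dstr.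
Proof. apply prod_sum_ext; cat; reflexivity. Qed.

(** The coalgebra is the one in right iteration preservation; this rewrites that condition in terms
    of the strength. *)
Lemma coit_dstrength W A Z Y (g : W × A ~> Y) (h : Z ~> A ⊕ Z) :
  coit ((g ⊕m id (W × Z)) ∘ dstr ∘ (id W ×m h)) = dmap g ∘ dstrength ∘ (id W ×m coit h).
Proof.
  symmetry; apply coit_uniq.
  rewrite !comp_assoc, out_dmap, <- (comp_assoc _ out).
  unfold dstrength at 1; rewrite coit_out; fold (@dstrength C S D P E W A).
  rewrite <- !comp_assoc, prod_map_comp, coit_out, id_l.
  rewrite <- (id_l (id W)), <- prod_map_comp, id_l, (comp_assoc dstr), dstr_sum_map.
  rewrite !comp_assoc, !sum_map_comp, !id_l, !id_r, <- !comp_assoc; reflexivity.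
Qed.

Lemma coit_sum_map X Y Z (g : X ~> Y) (h : Z ~> X ⊕ Z) :
  coit ((g ⊕m id Z) ∘ h) = dmap g ∘ coit h.
Proof.
  symmetry; apply coit_uniq; rewrite comp_assoc, out_dmap, <- comp_assoc, coit_out.
  rewrite !comp_assoc, !sum_map_comp, !id_l, !id_r; reflexivity.
Qed.

(** The coalgebra is the one in the compositionality axiom. A state in [Y] runs [h] and passes into
    [f] without an extra step, which is Kleisli composition. *)
Lemma coit_compose A X Y (f : X ~> A ⊕ X) (h : Y ~> X ⊕ Y) :
  coit (⟦ (id A ⊕m cinl) ∘ f , cinr ∘ cinr ⟧ ∘ ⟦ cinl , h ⟧)
    = ⟦ coit f , kl (coit f) ∘ coit h ⟧.
Proof.
  symmetry; apply coit_uniq; rewrite comp_copairing, !comp_assoc, kl_out.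
  rewrite <- (comp_assoc _ out), !coit_out, comp_assoc, copairing_sum_map, id_r.
  assert (H : forall g, (id A ⊕m coit f) ∘ f
    = (id A ⊕m ⟦ coit f , g ⟧) ∘ ((id A ⊕m cinl (Y := Y)) ∘ f)).
  { intro g; rewrite comp_assoc, sum_map_comp, copairing_l, id_l; reflexivity. }
  apply sum_ext; cat; [apply H |].
  rewrite (comp_assoc _ _ h); f_equal; apply sum_ext; cat; [apply H | reflexivity].
Qed.

Definition const_delay {X Y} : X × delay Y ~> delay X := dmap cfst ∘ dstrength.

Lemma const_delay_nat X X' Y Y' (f : X ~> X') (g : Y ~> Y') :
  const_delay ∘ (f ×m dmap g) = dmap f ∘ const_delay.
Proof. apply strong_delay_unique; unfold const_delay; cat; reflexivity. Qed.

End Strength.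

(** * Search-algebras: the retraction, epimorphisms and Elgot structure *)

Section SearchAlgebras.
Context {C : Category} {P : FiniteProducts C} {S : FiniteCoproducts C}
  {E : Extensive C} {D : DelayCoalgebras C}.
Implicit Types A B W X Y Z : C.

(* [c] overwrites the result of [L] by a given element of [A]; as it restricts to an overwriting of
   [K] along [q], the section [⟨ b , id L ⟩] of [c] exhibits [g] as an epimorphism. *)
Lemma epic_of_section W K L A B (q : B ~> A) (g : K ~> L)
    (c : A × L ~> L) (c' : B × L ~> K) (b : L ~> A) :
  (forall Y, epic (id Y ×m q)) ->
  c ∘ (q ×m id L) = g ∘ c' -> c ∘ ⟨ b , id L ⟩ = id L -> epic (id W ×m g).
Proof.
  intros Hq e1 e2 Z u v e.
  pose (p := ⟨ cfst ∘ cfst , c ∘ ⟨ csnd , csnd ∘ cfst ⟩ ⟩ : (W × L) × A ~> W × L).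
  assert (H : p ∘ ⟨ id _ , b ∘ csnd ⟩ = id (W × L)).
  { unfold p; cat.
    rewrite <- (id_l csnd) at 2; rewrite <- pairing_comp, comp_assoc, e2; cat; reflexivity. }
  rewrite <- (id_r u), <- (id_r v), <- H, !comp_assoc; f_equal.
  apply (Hq (W × L)).
  assert (Hp : p ∘ (id _ ×m q) =
    (id W ×m g) ∘ ⟨ cfst ∘ cfst , c' ∘ ⟨ csnd , csnd ∘ cfst ⟩ ⟩).
  { unfold p; cat. rewrite (comp_assoc g c'), <- e1; cat; reflexivity. }
  rewrite <- !comp_assoc, Hp, !comp_assoc, e; reflexivity.
Qed.

Context {A B : C} (q : B ~> A) (Hq : forall Y, epic (id Y ×m q)).
Context (a : delay A ~> A) (Ha : is_search_algebra a).

Lemma search_now : a ∘ now = id A. Proof. apply Ha. Qed.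
Lemma search_later : a ∘ later = a. Proof. apply Ha. Qed.
Lemma search_later_comp W (f : W ~> delay A) : a ∘ (later ∘ f) = a ∘ f.
Proof. now rewrite comp_assoc, search_later. Qed.

(* Replacing the value of [d] by [a d] changes nothing: if [d] terminates at all, its
   value is [a d]. *)
Lemma const_delay_search : const_delay ∘ ⟨ a , id (delay A) ⟩ = id (delay A).
Proof.
  unfold const_delay; apply delay_unique; cat; rewrite ?search_now, ?search_later;
    cat; reflexivity.
Qed.

(** Two-layer version: [a] ignores the outer delays, and at an outer [now] the claim is
    [const_delay_search]. *)
Lemma const_delay_search2 :
  dmap const_delay ∘ dstrength ∘ ⟨ a ∘ dmult , id (delay (delay A)) ⟩ = id _.
Proof.
  apply delay_unique; cat; rewrite ?search_later_comp; try reflexivity.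
  now rewrite const_delay_search; cat.
Qed.

Lemma dmap_epic W : epic (id W ×m dmap q).
Proof.
  apply epic_of_section with (q := q) (c := const_delay) (c' := const_delay) (b := a).
  - exact Hq.
  - rewrite <- dmap_id, const_delay_nat; reflexivity.
  - exact const_delay_search.
Qed.

Lemma dmap_dmap_epic W : epic (id W ×m dmap (dmap q)).
Proof.
  apply epic_of_section with (q := q) (c := dmap const_delay ∘ dstrength)
    (c' := dmap const_delay ∘ dstrength) (b := a ∘ dmult).
  - exact Hq.
  - rewrite comp_assoc, <- dmap_comp, <- (const_delay_nat q (id A)), dmap_id, dmap_comp.
    rewrite <- !comp_assoc, dstrength_nat, !dmap_id; reflexivity.
  - exact const_delay_search2.
Qed.

Lemma epic_id_prod X Y (f : X ~> Y) : epic (id one ×m f) -> epic f.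
Proof.
  intros Hf Z h k e.
  assert (H : csnd ∘ ⟨ bang Y , id Y ⟩ = id Y) by apply pairing_snd.
  rewrite <- (id_r h), <- (id_r k), <- H, !comp_assoc; f_equal; apply Hf.
  cat; rewrite !(comp_assoc _ f), e; reflexivity.
Qed.

(** The law for [b] is transported along [dmap (dmap q)], which is epic by [dmap_dmap_epic]. *)
Lemma search_algebra_assoc (b : delay B ~> B) :
  b ∘ dmap b = b ∘ dmult -> is_dalg_morphism b a q -> a ∘ dmap a = a ∘ dmult.
Proof.
  unfold is_dalg_morphism; intros eb e; apply (epic_id_prod (@dmap_dmap_epic one)).
  rewrite <- !comp_assoc, <- dmap_dmult, <- dmap_comp, <- e, dmap_comp, !comp_assoc.
  rewrite <- e, <- !comp_assoc, eb; reflexivity.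
Qed.

(** Associativity leaves [a ∘ iota A = cfst] to prove. Both sides are the recursion with start
    [id A] and step [id A], because [a] absorbs [later]. *)
Lemma search_kl_iota {N : StableNNO C} :
  a ∘ dmap a = a ∘ dmult -> a ∘ kl (iota A) = a ∘ dmap cfst.
Proof.
  intros e; rewrite <- dmult_dmap, comp_assoc, <- e, <- comp_assoc, <- dmap_comp.
  do 2 f_equal.
  transitivity (nrec (id A) (id A)); [| symmetry]; apply nrec_uniq; unfold iota.
  - rewrite <- comp_assoc, nrec_zero; apply search_now.
  - rewrite <- comp_assoc, nrec_succ, comp_assoc, search_later, id_l; reflexivity.
  - apply pairing_fst.
  - cat; reflexivity.
Qed.

(** This is what lets the extension [a ∘ dmap f] of [f] descend to the quotient. *)
Lemma search_extension_iota {N : StableNNO C} X (f : X ~> A) :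
  a ∘ dmap a = a ∘ dmult -> a ∘ dmap f ∘ kl (iota X) = a ∘ dmap f ∘ dmap cfst.
Proof.
  intros e; rewrite <- !comp_assoc, dmap_kl, iota_nat, <- kl_dmap, comp_assoc.
  rewrite (search_kl_iota e), <- !comp_assoc, <- !dmap_comp; cat; reflexivity.
Qed.

Lemma search_out_inv : a ∘ out_inv = ⟦ id A , a ⟧.
Proof.
  apply copairing_uniq; rewrite <- comp_assoc; [exact search_now | exact search_later].
Qed.

(** Fixpoint comes from the search laws, uniformity from uniqueness of [coit], compositionality from
    [coit_compose] and [Haa]. The definition is transparent so that [dag] later computes to
    [a ∘ coit f]. *)
Definition search_elgot (Haa : a ∘ dmap a = a ∘ dmult) : Elgot A.
Proof.
  refine {| dag Z f := a ∘ coit f |}.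
  - intros Z f; rewrite <- (id_l (coit f)) at 1.
    rewrite <- out_invK, <- comp_assoc, coit_out, !comp_assoc, search_out_inv.
    rewrite copairing_sum_map, id_l; reflexivity.
  - intros Y Z f g h e; rewrite <- comp_assoc; f_equal; symmetry; apply coit_uniq.
    rewrite comp_assoc, coit_out, <- comp_assoc, <- e, comp_assoc, sum_map_comp, id_l.
    reflexivity.
  - intros X Y f h.
    rewrite coit_sum_map, coit_compose, <- comp_assoc, copairing_r, dmap_comp, !comp_assoc, Haa.
    rewrite <- (comp_assoc a dmult), dmult_dmap; reflexivity.
Defined.

End SearchAlgebras.

(** * From Elgot algebras back to search-algebras *)

Section Elgot.
Context {C : Category} {P : FiniteProducts C} {S : FiniteCoproducts C}
  {E : Extensive C} {D : DelayCoalgebras C}.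
Context {A : C} (EA : Elgot A).

(** Uniformity along the coalgebra morphism [coit h]; the whole operator is thus determined by
    [dag EA out]. *)
Lemma dag_coit (Z : C) (h : Z ~> A ⊕ Z) : dag EA h = dag EA out ∘ coit h.
Proof. apply dag_uniformity; symmetry; apply coit_out. Qed.

Lemma elgot_search : is_search_algebra (dag EA out).
Proof.
  split; rewrite dag_fixpoint at 1; cat; reflexivity.
Qed.

(** Compositionality with both coalgebras equal to [out], restricted to the right summand, where
    [coit_compose] yields [kl (id _)], that is [dmult]. *)
Lemma elgot_assoc : dag EA out ∘ dmap (dag EA out) = dag EA out ∘ dmult.
Proof.
  assert (H := dag_compositionality EA out out).
  rewrite dag_coit, coit_sum_map, (dag_coit (_ ∘ _)), coit_compose in H.
  rewrite !coit_out_id, id_r, <- comp_assoc, copairing_r, id_r in H; exact H.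
Qed.
End Elgot.

(** * Interaction of the strength with [iota] *)

Section StrengthIota.
Context {C : Category} {P : FiniteProducts C} {S : FiniteCoproducts C}
  {E : Extensive C} {N : StableNNO C} {D : DelayCoalgebras C}.
Implicit Types A B W X Y Z : C.

Lemma iota_zero W X (f : W ~> X) (g : W ~> one) : iota X ∘ ⟨ f , nzero ∘ g ⟩ = now ∘ f.
Proof.
  transitivity (iota X ∘ ⟨ id X , nzero ∘ bang X ⟩ ∘ f).
  - cat; rewrite (bang_uniq g); reflexivity.
  - unfold iota; rewrite nrec_zero; reflexivity.
Qed.

Lemma iota_succ W X (f : W ~> X) (g : W ~> nno) :
  iota X ∘ ⟨ f , nsucc ∘ g ⟩ = later ∘ (iota X ∘ ⟨ f , g ⟩).
Proof.
  transitivity (iota X ∘ (id X ×m nsucc) ∘ ⟨ f , g ⟩).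
  - cat; reflexivity.
  - unfold iota; rewrite nrec_succ, <- comp_assoc; reflexivity.
Qed.

Lemma dstrength_iota W X :
  dstrength ∘ (id W ×m iota X)
    = iota (W × X) ∘ ⟨ ⟨ cfst , cfst ∘ csnd ⟩ , csnd ∘ csnd ⟩.
Proof.
  assert (H : dstrength ∘ (id W ×m iota X) ∘ passoc = iota (W × X)).
  { apply nrec_uniq; unfold passoc; cat; rewrite ?iota_zero, ?iota_succ; cat; reflexivity. }
  rewrite <- H, <- !comp_assoc; do 2 f_equal.
  unfold passoc; cat; reflexivity.
Qed.

(** This makes maps out of [delay (W × X)] descend along [id W ×m q], both for the free extension
    and for the strength of the quotient. *)
Lemma dstrength_coequalizes W X Z (h : delay (W × X) ~> Z) :
  h ∘ kl (iota (W × X)) = h ∘ dmap cfst ->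
  h ∘ dstrength ∘ (id W ×m kl (iota X))
    = h ∘ dstrength ∘ (id W ×m dmap (cfst : X × nno ~> X)).
Proof.
  intro e; rewrite <- !comp_assoc, dstrength_kl, dstrength_iota, <- kl_dmap.
  rewrite <- dstrength_nat, !comp_assoc, e, <- (comp_assoc h), <- dmap_comp; cat.
  reflexivity.
Qed.
End StrengthIota.

(** * The quotient as a stable free Elgot algebra *)

Section Free.
Context {C : Category} {P : FiniteProducts C} {S : FiniteCoproducts C}
  {E : Extensive C} {N : StableNNO C} {D : DelayCoalgebras C}.
Context {X F : C} (q : delay X ~> F)
  (Hq : forall Y, is_coequalizer (id Y ×m kl (iota X))
          (id Y ×m dmap (cfst : X × nno ~> X)) (id Y ×m q))
  (EF : Elgot F) (Hm : is_dalg_morphism dmult (dag EF out) q).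

(** The right-hand side unfolds to [dag EF out ∘ dmap (q ∘ now)]; the morphism law [Hm] and a monad
    unit law reduce it to [q]. *)
Lemma quotient_dag : q = dag EF (((q ∘ now) ⊕m id (delay X)) ∘ out).
Proof.
  rewrite dag_coit, coit_sum_map, coit_out_id, id_r, dmap_comp, comp_assoc, <- Hm.
  rewrite <- comp_assoc, dmult_dmap, kl_id, id_r; reflexivity.
Qed.

Lemma quotient_stable_free : is_stable_free_elgot EF (q ∘ now).
Proof.
  assert (Hq' : forall Y, epic (id Y ×m q)) by (intro Y; apply (coequalizer_epic (Hq Y))).
  assert (HqD := @dmap_epic _ _ _ _ _ _ _ q Hq' _ (elgot_search EF)).
  unfold is_dalg_morphism in Hm.
  intros W A EA f.
  set (a := dag EA out).
  (* The extension is forced on representatives: apply [f] under the delay, then evaluate in [A]. *)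
  destruct (proj2 (Hq W) A (a ∘ dmap f ∘ dstrength)) as [g [eg _]].
  { apply dstrength_coequalizes, search_extension_iota.
    - apply elgot_search.
    - apply elgot_assoc. }
  exists g; split; [split |].
  - intros Z h; rewrite (dag_coit EF), (dag_coit EA), coit_dstrength; fold a.
    (* By [dag_coit] it suffices to preserve iteration of [out], which is checked on the epimorphism
       [id W ×m dmap q]. *)
    assert (H : g ∘ (id W ×m dag EF out) = a ∘ dmap g ∘ dstrength).
    { apply HqD.
      assert (e1 : (id W ×m dag EF out) ∘ (id W ×m dmap q) = (id W ×m q) ∘ (id W ×m dmult)).
      { rewrite !prod_map_comp, Hm; reflexivity. }
      assert (e2 : dmap g ∘ dstrength ∘ (id W ×m dmap q) =
         dmap a ∘ (dmap (dmap f) ∘ (dmap dstrength ∘ dstrength))).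
      { rewrite <- comp_assoc, <- dstrength_nat, comp_assoc, <- dmap_comp, eg.
        rewrite !dmap_comp, <- !comp_assoc; reflexivity. }
      rewrite <- !comp_assoc, e1, (comp_assoc g), eg.
      rewrite (comp_assoc (dmap g)), e2, (comp_assoc a); unfold a at 2 3; rewrite elgot_assoc.
      fold a; rewrite <- !comp_assoc; f_equal; rewrite dstrength_dmult, <- !comp_assoc.
      rewrite comp_assoc, dmap_dmult, <- comp_assoc; reflexivity. }
    transitivity (g ∘ (id W ×m dag EF out) ∘ (id W ×m coit h)).
    + rewrite <- comp_assoc, prod_map_comp, id_l; reflexivity.
    + rewrite H, <- !comp_assoc; reflexivity.
  - rewrite <- (id_l (id W)), <- prod_map_comp, comp_assoc, eg, <- comp_assoc.
    rewrite dstrength_now, <- comp_assoc, dmap_now, comp_assoc; unfold a.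
    rewrite (proj1 (elgot_search EA)), id_l; reflexivity.
  (* By [quotient_dag], [q] is itself an iteration, so preservation determines [g'] on [id W ×m q]
     from its values on the unit. *)
  - intros g' [Hg' eg']; apply (Hq' W); rewrite eg.
    rewrite quotient_dag at 1; rewrite Hg', (dag_coit EA), coit_dstrength.
    rewrite coit_sum_map, coit_out_id, id_r, <- (comp_assoc _ dstrength), <- dstrength_nat.
    rewrite (comp_assoc (dmap g')), <- dmap_comp, <- eg', !comp_assoc; reflexivity.
Qed.
End Free.

(** * Counting the outer steps of a nested computation *)

Section Counting.
Context {C : Category} {P : FiniteProducts C} {S : FiniteCoproducts C}
  {E : Extensive C} {N : StableNNO C} {D : DelayCoalgebras C}.
Implicit Types A B W X Y Z : C.

(* [count (n, later^k (now x)) = later^k (now (n + k, x))] *)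
Definition count {X} : nno × delay X ~> delay (nno × X) :=
  coit ((id (nno × X) ⊕m (nsucc ×m id (delay X))) ∘ dstr ∘ (id nno ×m out)).

Lemma count_now X : count ∘ (id nno ×m now) = (now : nno × X ~> _).
Proof. apply out_mono; unfold count; rewrite comp_assoc, coit_out; cat; reflexivity. Qed.

Lemma count_later X :
  count ∘ (id nno ×m later) = later ∘ count ∘ (nsucc ×m id (delay X)).
Proof. apply out_mono; unfold count; rewrite comp_assoc, coit_out; cat; reflexivity. Qed.

Lemma dmap_count_unique X Y (f : nno × X ~> Y) (h : nno × delay X ~> delay Y) :
  h ∘ (id nno ×m now) = now ∘ f ->
  h ∘ (id nno ×m later) = later ∘ h ∘ (nsucc ×m id (delay X)) ->
  dmap f ∘ count = h.
Proof.
  intros e1 e2; apply parametric_delay_unique with (t := nsucc); [| | exact e2].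
  - rewrite e1, <- comp_assoc, count_now; apply dmap_now.
  - rewrite <- comp_assoc, count_later, <- comp_assoc, !comp_assoc, dmap_later; reflexivity.
Qed.

Definition lstrength {X} : nno × delay X ~> delay (X × nno) :=
  dmap ⟨ csnd , cfst ⟩ ∘ dstrength.

(* [delay_by (n, d) = later^n d] *)
Definition delay_by {X} : nno × delay X ~> delay X := kl (iota X) ∘ lstrength.

Lemma delay_by_later X :
  delay_by ∘ (id nno ×m later) = later ∘ (delay_by : nno × delay X ~> _).
Proof. unfold delay_by, lstrength; cat; reflexivity. Qed.

Lemma delay_by_succ X :
  delay_by ∘ (nsucc ×m id (delay X)) = later ∘ (delay_by : nno × delay X ~> _).
Proof.
  apply strong_delay_unique; unfold delay_by, lstrength; cat; rewrite ?iota_succ; cat; reflexivity.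
Qed.

Lemma delay_by_zero X : delay_by ∘ ⟨ nzero ∘ bang (delay X) , id _ ⟩ = id (delay X).
Proof.
  apply delay_unique; unfold delay_by, lstrength; cat.
  - rewrite iota_zero; apply id_r.
  - reflexivity.
  - reflexivity.
Qed.

(** On [(n, later^k (now d))] both sides give [later^k (now (later^(n+k) d))]. *)
Lemma dmap_delay_by_count X :
  dmap delay_by ∘ count
    = const_delay ∘ ⟨ delay_by ∘ (id nno ×m dmult) , (csnd : nno × delay (delay X) ~> _) ⟩.
Proof.
  apply dmap_count_unique; unfold const_delay; cat.
  - reflexivity.
  (* An outer [later] arrives as an inner [later] through [dmult] on one side and as [nsucc] on the
     other; [delay_by] treats the two alike. *)
  - assert (e1 := delay_by_later X); assert (e2 := delay_by_succ X).
    cat_in e1; cat_in e2.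
    assert (H1 := f_equal (fun k => k ∘ (id nno ×m dmult)) e1).
    assert (H2 := f_equal (fun k => k ∘ (id nno ×m dmult)) e2).
    cat_in H1; cat_in H2; rewrite H1, H2; reflexivity.
Qed.

(* [later^n (now d)] is sent to [later^n (now (tag d n))], where [tag d n] returns
   [(x, n)] when [d] returns [x]. *)
Definition tag_count {X} : delay (delay X) ~> delay (delay (X × nno)) :=
  dmap lstrength ∘ count ∘ ⟨ nzero ∘ bang (delay (delay X)) , id _ ⟩.

Lemma dmap_fst_tag_count X : dmap (dmap cfst) ∘ tag_count = id (delay (delay X)).
Proof.
  assert (H : dmap (dmap cfst ∘ lstrength) ∘ count = (csnd : nno × delay (delay X) ~> _)).
  { unfold lstrength; rewrite comp_assoc, <- dmap_comp, pairing_fst, dstrength_snd.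
    apply dmap_count_unique; cat; reflexivity. }
  unfold tag_count; rewrite !comp_assoc, <- dmap_comp, H; apply pairing_snd.
Qed.

(** Spending the tag turns [later^n (now d)] into [later^n (now (later^n d))], while
    [dmap_fst_tag_count] forgets it. A map coequalizing the [D]-images therefore cannot distinguish
    these two computations. *)
Lemma dmap_iota_tag_count X :
  dmap (kl (iota X)) ∘ tag_count = const_delay ∘ ⟨ dmult , id (delay (delay X)) ⟩.
Proof.
  unfold tag_count; rewrite !comp_assoc, <- dmap_comp; fold (@delay_by X).
  rewrite dmap_delay_by_count; cat; do 2 f_equal.
  transitivity (delay_by ∘ ⟨ nzero ∘ bang (delay X) , id _ ⟩ ∘ dmult).
  - cat; reflexivity.
  - rewrite delay_by_zero; apply id_l.
Qed.

End Counting.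

(** * Preservation by [D] versus search-algebra structure *)

Section Preservation.
Context {C : Category} {P : FiniteProducts C} {S : FiniteCoproducts C}
  {E : Extensive C} {N : StableNNO C} {D : DelayCoalgebras C}.
Context {X F : C} (q : delay X ~> F) (q_eq : q ∘ kl (iota X) = q ∘ dmap cfst).

Lemma quotient_later : q ∘ later = q.
Proof.
  (* Evaluate the coequalizer equation at the numeral one, where [kl (iota X)] becomes [later]. *)
  assert (H := f_equal (fun k => k ∘ dmap ⟨ id X , nsucc ∘ (nzero ∘ bang X) ⟩) q_eq).
  cbn beta in H; rewrite <- !comp_assoc, kl_dmap, <- dmap_comp, iota_succ, iota_zero in H.
  rewrite pairing_fst, dmap_id, !id_r, kl_now_later in H; exact H.
Qed.

Lemma search_of_preserved :
  epic q -> is_coequalizer (dmap (kl (iota X))) (dmap (dmap cfst)) (dmap q) ->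
  exists a : delay F ~> F, is_search_algebra a /\ is_dalg_morphism dmult a q.
Proof.
  intros Hq Hd.
  (* The morphism condition leaves no other choice for [a]; the search laws are then inherited from
     [dmult] and [quotient_later]. *)
  destruct (proj2 Hd F (q ∘ dmult)) as [a [ea _]].
  { rewrite <- !comp_assoc, dmult_dmap, <- dmap_dmult, comp_assoc, <- q_eq.
    rewrite <- (id_r (kl (iota X))) at 1; rewrite kl_kl, comp_assoc; reflexivity. }
  exists a; split; [split | symmetry; exact ea].
  - apply Hq; rewrite <- comp_assoc, <- dmap_now, comp_assoc, ea, <- comp_assoc, dmult_now.
    rewrite id_l, id_r; reflexivity.
  - apply (coequalizer_epic Hd); rewrite <- comp_assoc, <- dmap_later, comp_assoc, ea.
    rewrite <- comp_assoc, dmult_later, comp_assoc, quotient_later; reflexivity.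
Qed.

Lemma preserved_of_search (a : delay F ~> F) :
  (forall Y, is_coequalizer (id Y ×m kl (iota X)) (id Y ×m dmap cfst) (id Y ×m q)) ->
  is_search_algebra a -> is_dalg_morphism dmult a q ->
  is_coequalizer (dmap (kl (iota X))) (dmap (dmap cfst)) (dmap q).
Proof.
  intros Hq Ha Hm.
  assert (Hd : epic (dmap q)).
  { apply epic_id_prod, (dmap_epic (fun Y => coequalizer_epic (Hq Y)) Ha). }
  (* The arguments are swapped so that the quotiented component is the second factor, as in [Hq]. *)
  assert (Hc : forall B B' (b : B ~> B'),
    (const_delay ∘ ⟨ csnd , cfst ⟩) ∘ (id (delay F) ×m b)
      = dmap b ∘ (const_delay ∘ ⟨ csnd , cfst ⟩)).
  { intros B B' b; rewrite comp_assoc, <- (const_delay_nat b (id F)), dmap_id; cat.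
    reflexivity. }
  split.
  - rewrite <- !dmap_comp, q_eq; reflexivity.
  - intros Z h eh.
    destruct (proj2 (Hq (delay F)) Z (h ∘ (const_delay ∘ ⟨ csnd , cfst ⟩))) as [g [eg _]].
    { rewrite <- !(comp_assoc h), !Hc, !comp_assoc, eh; reflexivity. }
    (* On [dmap q] the factorization becomes [h ∘ const_delay ∘ ⟨ dmult , id _ ⟩], which the tagging
       argument identifies with [h]. *)
    assert (H : g ∘ ⟨ id _ , a ⟩ ∘ dmap q = h).
    { transitivity (g ∘ (id _ ×m q) ∘ ⟨ dmap q , dmult ⟩).
      { cat; rewrite Hm; reflexivity. }
      transitivity (h ∘ (const_delay ∘ (id _ ×m dmap q) ∘ ⟨ dmult , id _ ⟩)).
      { rewrite eg; cat; reflexivity. }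
      rewrite const_delay_nat, dmap_id, id_l, <- dmap_iota_tag_count, comp_assoc, eh.
      rewrite <- comp_assoc, dmap_fst_tag_count, id_r; reflexivity. }
    exists (g ∘ ⟨ id _ , a ⟩); split; [exact H |].
    intros k ek; apply Hd; rewrite ek; exact H.
Qed.
End Preservation.

(** * Search-algebras from a monad structure on the quotient, and conversely *)

Section Monad.
Context {C : Category} {P : FiniteProducts C} {S : FiniteCoproducts C}
  {E : Extensive C} {N : StableNNO C} {D : DelayCoalgebras C}.
Context (Q : forall X : C, Coequalizer (kl (iota X)) (dmap (cfst : X × nno ~> X)))
  (Qprod : forall Y X : C,
      is_coequalizer (id Y ×m kl (iota X)) (id Y ×m dmap (cfst : X × nno ~> X))
        (id Y ×m rho Q X)).
Implicit Types W X Y Z : C.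

Lemma prod_rho_epic W X : epic (id W ×m rho Q X).
Proof. exact (coequalizer_epic (Qprod W X)). Qed.

Lemma rho_epic X : epic (rho Q X).
Proof. apply epic_id_prod, prod_rho_epic. Qed.

Lemma rho_later X : rho Q X ∘ later = rho Q X.
Proof. apply quotient_later, coeq_eq. Qed.

(** The free algebra of the quotient monad is restricted along [rho]; [later] is absorbed because
    [rho] already absorbs it. *)
Lemma search_of_monad (M : StrongMonadData (qdelay_functor Q)) X :
  is_strong_monad M -> is_strong_monad_morphism delay_monad M (rho Q) ->
  exists a : delay (qdelay Q X) ~> qdelay Q X,
    is_search_algebra a /\ is_dalg_morphism dmult a (rho Q X).
Proof.
  intros HM Hr.
  pose (m := mmult M X : qdelay Q (qdelay Q X) ~> qdelay Q X).
  exists (m ∘ rho Q (qdelay Q X)).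
  assert (Hu : m ∘ (rho Q (qdelay Q X) ∘ now) = id _).
  { etransitivity; [| exact (mmult_unit_l HM X)].
    exact (f_equal (comp m) (mmor_unit Hr (qdelay Q X))). }
  assert (Hμ : rho Q X ∘ dmult = m ∘ qmap Q (rho Q X) ∘ rho Q (delay X))
    by exact (mmor_mult Hr X).
  split; [split |].
  - rewrite <- comp_assoc; exact Hu.
  - rewrite <- comp_assoc, rho_later; reflexivity.
  - unfold is_dalg_morphism; rewrite <- comp_assoc, <- qmap_rho, comp_assoc; exact Hμ.
Qed.

Context (alpha : forall X, delay (qdelay Q X) ~> qdelay Q X)
  (Hs : forall X, is_search_algebra (alpha X))
  (Hm : forall X, is_dalg_morphism dmult (alpha X) (rho Q X)).

Lemma prod_dmap_rho_epic W X : epic (id W ×m dmap (rho Q X)).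
Proof. exact (dmap_epic (fun Y => @prod_rho_epic Y X) (Hs X) (W := W)). Qed.

Lemma dmap_rho_epic X : epic (dmap (rho Q X)).
Proof. apply epic_id_prod, prod_dmap_rho_epic. Qed.

Lemma alpha_assoc X : alpha X ∘ dmap (alpha X) = alpha X ∘ dmult.
Proof.
  apply (search_algebra_assoc (fun Y => @prod_rho_epic Y X) (Hs X) (b := dmult)).
  - symmetry; apply dmult_dmult.
  - apply Hm.
Qed.

Definition qmult X : qdelay Q (qdelay Q X) ~> qdelay Q X :=
  coeq_desc (Q (qdelay Q X)) (search_kl_iota (Hs X) (alpha_assoc X)).

Lemma qmult_rho X : qmult X ∘ rho Q (qdelay Q X) = alpha X.
Proof. apply coeq_desc_map. Qed.

Lemma qstrength_exists X Y :
  exists t : X × qdelay Q Y ~> qdelay Q (X × Y),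
    t ∘ (id X ×m rho Q Y) = rho Q (X × Y) ∘ dstrength.
Proof.
  destruct (proj2 (Qprod X Y) _ (rho Q (X × Y) ∘ dstrength)) as [t [et _]].
  - apply dstrength_coequalizes, coeq_eq.
  - exists t; exact et.
Qed.

(** [Qprod] gives mere existence in [Prop], so choice extracts the map as data. *)
Definition qstrength X Y : X × qdelay Q Y ~> qdelay Q (X × Y) :=
  proj1_sig (constructive_indefinite_description _ (qstrength_exists X Y)).

Lemma qstrength_rho X Y :
  qstrength X Y ∘ (id X ×m rho Q Y) = rho Q (X × Y) ∘ dstrength.
Proof. apply (proj2_sig (constructive_indefinite_description _ (qstrength_exists X Y))). Qed.

Definition qdelay_monad : StrongMonadData (qdelay_functor Q) :=
  {| munit := (fun X => rho Q X ∘ now) : forall X, X ~> qdelay_functor Q X;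
     mmult := qmult : forall X, qdelay_functor Q (qdelay_functor Q X) ~> qdelay_functor Q X;
     mstr := qstrength : forall X Y, X × qdelay_functor Q Y ~> qdelay_functor Q (X × Y) |}.

Lemma qmult_qmap X Y (f : X ~> qdelay Q Y) :
  qmult Y ∘ qmap Q f ∘ rho Q X = alpha Y ∘ dmap f.
Proof. rewrite <- comp_assoc, qmap_rho, comp_assoc, qmult_rho; reflexivity. Qed.

Lemma qmult_nat X Y (f : X ~> Y) :
  qmap Q f ∘ qmult X = qmult Y ∘ qmap Q (qmap Q f).
Proof.
  (* The first epimorphism replaces [qmult] by [alpha], the second replaces [alpha] by [dmult]
     through [Hm]; [qmult_assoc] and [qstrength_mult] follow the same pattern. *)
  apply rho_epic; rewrite qmult_qmap, <- comp_assoc, qmult_rho; apply dmap_rho_epic.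
  rewrite <- !comp_assoc, <- dmap_comp, qmap_rho, dmap_comp, <- Hm, (comp_assoc (qmap Q f)).
  rewrite qmap_rho, <- comp_assoc, dmap_dmult, !comp_assoc, <- Hm; reflexivity.
Qed.

Lemma qmult_unit_l X : qmult X ∘ (rho Q (qdelay Q X) ∘ now) = id _.
Proof. rewrite comp_assoc, qmult_rho; apply Hs. Qed.

Lemma qmult_unit_r X : qmult X ∘ qmap Q (rho Q X ∘ now) = id _.
Proof.
  apply rho_epic; rewrite qmult_qmap, dmap_comp, comp_assoc, <- Hm, <- comp_assoc.
  rewrite dmult_dmap, kl_id, id_l, id_r; reflexivity.
Qed.

Lemma qmult_assoc X : qmult X ∘ qmult (qdelay Q X) = qmult X ∘ qmap Q (qmult X).
Proof.
  apply rho_epic; rewrite qmult_qmap, <- comp_assoc, qmult_rho; apply dmap_rho_epic.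
  rewrite <- !comp_assoc, <- dmap_comp, qmult_rho, alpha_assoc, <- Hm, comp_assoc, qmult_rho.
  reflexivity.
Qed.

Lemma qstrength_nat X X' Y Y' (f : X ~> X') (g : Y ~> Y') :
  qmap Q (f ×m g) ∘ qstrength X Y = qstrength X' Y' ∘ (f ×m qmap Q g).
Proof.
  apply prod_rho_epic; rewrite <- !comp_assoc, qstrength_rho, comp_assoc, qmap_rho.
  rewrite <- comp_assoc, dstrength_nat, comp_assoc, <- qstrength_rho, <- comp_assoc.
  rewrite !prod_map_comp, qmap_rho, id_l, id_r; reflexivity.
Qed.

Lemma qstrength_one X : qmap Q csnd ∘ qstrength one X = csnd.
Proof.
  apply prod_rho_epic; rewrite <- comp_assoc, qstrength_rho, comp_assoc, qmap_rho.
  rewrite <- comp_assoc, dstrength_snd; cat; reflexivity.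
Qed.

Lemma qstrength_assoc X Y Z :
  qmap Q passoc ∘ qstrength (X × Y) Z
    = qstrength X (Y × Z) ∘ (id X ×m qstrength Y Z) ∘ passoc.
Proof.
  apply prod_rho_epic; rewrite <- !comp_assoc, qstrength_rho, comp_assoc, qmap_rho.
  assert (H : passoc ∘ (id (X × Y) ×m rho Q Z) = (id X ×m (id Y ×m rho Q Z)) ∘ passoc).
  { unfold passoc; cat; reflexivity. }
  rewrite <- comp_assoc, dstrength_assoc, H, (comp_assoc (id X ×m qstrength Y Z)).
  rewrite prod_map_comp, qstrength_rho, <- (prod_map_comp (id X)), !comp_assoc.
  rewrite qstrength_rho; reflexivity.
Qed.

Lemma qstrength_unit X Y :
  qstrength X Y ∘ (id X ×m (rho Q Y ∘ now)) = rho Q (X × Y) ∘ now.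
Proof.
  rewrite <- (id_l (id X)), <- prod_map_comp, comp_assoc, qstrength_rho, <- comp_assoc.
  rewrite dstrength_now; reflexivity.
Qed.

Lemma qstrength_mult X Y :
  qstrength X Y ∘ (id X ×m qmult Y)
    = qmult (X × Y) ∘ qmap Q (qstrength X Y) ∘ qstrength X (qdelay Q Y).
Proof.
  apply prod_rho_epic; apply prod_dmap_rho_epic.
  rewrite <- !comp_assoc, (comp_assoc (qstrength X (qdelay Q Y))), qstrength_rho.
  rewrite !prod_map_comp, !id_l, (comp_assoc (qmult Y)), qmult_rho, <- Hm.
  rewrite <- (id_l (id X)) at 1; rewrite <- prod_map_comp, !comp_assoc, qmult_qmap.
  rewrite qstrength_rho, <- !comp_assoc, <- dstrength_nat, dstrength_dmult.
  rewrite !(comp_assoc (dmap _)), <- dmap_comp, qstrength_rho, dmap_comp, !comp_assoc.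
  rewrite <- Hm; reflexivity.
Qed.

Lemma qdelay_monad_strong : is_strong_monad qdelay_monad.
Proof.
  split; cbn.
  - intros X Y f; rewrite comp_assoc, qmap_rho, <- !comp_assoc, dmap_now; reflexivity.
  - exact qmult_nat.
  - exact qmult_unit_l.
  - exact qmult_unit_r.
  - exact qmult_assoc.
  - exact qstrength_nat.
  - exact qstrength_one.
  - exact qstrength_assoc.
  - exact qstrength_unit.
  - exact qstrength_mult.
Qed.

Lemma rho_monad_morphism : is_strong_monad_morphism delay_monad qdelay_monad (rho Q).
Proof.
  split; cbn.
  - intros X Y f; apply qmap_rho.
  - reflexivity.
  - intros X; rewrite qmult_qmap; apply Hm.
  - intros X Y; symmetry; apply qstrength_rho.
Qed.
End Monad.

(** * The equivalences, with every implication passing through [cond2] *)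

Theorem theorem6p6 (C : Category) (P : FiniteProducts C) (S : FiniteCoproducts C)
    (E : Extensive C) (N : StableNNO C) (NE : NatExponentials C)
    (D : DelayCoalgebras C)
    (Q : forall X : C, Coequalizer (kl (iota X)) (dmap (cfst : X × nno ~> X)))
    (Qprod : forall Y X : C,
      is_coequalizer (id Y ×m kl (iota X)) (id Y ×m dmap (cfst : X × nno ~> X))
        (id Y ×m rho Q X)) :
  let cond1 :=
    forall X : C,
      is_coequalizer (dmap (kl (iota X))) (dmap (dmap (cfst : X × nno ~> X)))
        (dmap (rho Q X)) in
  let cond2 :=
    forall X : C, exists alpha : delay (qdelay Q X) ~> qdelay Q X,
      is_search_algebra alpha /\ is_dalg_morphism dmult alpha (rho Q X) in
  let cond3 :=
    forall X : C, exists EX : Elgot (qdelay Q X),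
      is_stable_free_elgot EX (rho Q X ∘ now) /\
      is_dalg_morphism dmult (dag EX out) (rho Q X) /\
      rho Q X = dag EX (((rho Q X ∘ now) ⊕m id (delay X)) ∘ out) in
  let cond4 :=
    exists M : StrongMonadData (qdelay_functor Q),
      is_strong_monad M /\ is_strong_monad_morphism delay_monad M (rho Q) in
  (cond1 <-> cond2) /\ (cond2 <-> cond3) /\ (cond3 <-> cond4).
Proof.
  intros cond1 cond2 cond3 cond4.
  assert (Hrho : forall X Y, epic (id Y ×m rho Q X))
    by (intros X Y; exact (@prod_rho_epic _ _ _ _ _ Q Qprod Y X)).
  assert (H12 : cond1 -> cond2).
  { intros H X; apply search_of_preserved; [apply coeq_eq | | apply H].
    apply (rho_epic Qprod). }
  assert (H21 : cond2 -> cond1).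
  { intros H X; destruct (H X) as [a [Ha Hm]].
    apply (preserved_of_search (coeq_eq (Q X)) (fun Y => Qprod Y X) Ha Hm). }
  assert (H23 : cond2 -> cond3).
  { intros H X; destruct (H X) as [a [Ha Hm]].
    assert (Haa : a ∘ dmap a = a ∘ dmult).
    { apply (search_algebra_assoc (Hrho X) Ha (b := dmult)); [| exact Hm].
      symmetry; apply dmult_dmult. }
    assert (Hout : dag (search_elgot Ha Haa) out = a).
    { cbn; rewrite coit_out_id; apply id_r. }
    assert (Hm' : is_dalg_morphism dmult (dag (search_elgot Ha Haa) out) (rho Q X)).
    { rewrite Hout; exact Hm. }
    exists (search_elgot Ha Haa); split; [| split].
    - exact (quotient_stable_free (fun Y => Qprod Y X) Hm').
    - exact Hm'.
    - exact (quotient_dag Hm'). }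
  assert (H32 : cond3 -> cond2).
  { intros H X; destruct (H X) as [EX [_ [Hm _]]].
    exists (dag EX out); split; [apply elgot_search | exact Hm]. }
  assert (H24 : cond2 -> cond4).
  { intros H.
    (* The structures exist separately for each object; choice assembles them into one family. *)
    pose (alpha := fun X => proj1_sig (constructive_indefinite_description _ (H X))).
    assert (Ha : forall X,
      is_search_algebra (alpha X) /\ is_dalg_morphism dmult (alpha X) (rho Q X)).
    { intro X; exact (proj2_sig (constructive_indefinite_description _ (H X))). }
    exists (qdelay_monad Qprod (fun X => proj1 (Ha X)) (fun X => proj2 (Ha X))); split.
    - apply qdelay_monad_strong.
    - apply rho_monad_morphism. }
  assert (H42 : cond4 -> cond2).
  { intros [M [HM Hr]] X; exact (search_of_monad X HM Hr). }
  clearbody cond1 cond2 cond3 cond4; tauto.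
Qed.
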